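(* For every integer $n\ge1$, $$D_n(1,-1,t)=\sum_{k=0}^{n-1}\binom{n-1-k}{k}k!\,t^k.$$
   Context: For $n\in\mathbb{N}$, $[n]_{p,q}=\sum_{i+j=n-1}p^iq^j$ and $\binom{n}{k}_{p,q}=\frac{[n]_{p,q}\cdots[n-k+1]_{p,q}}{[1]_{p,q}\cdots[k]_{p,q}}$. The polynomials $D_n(p,q,t)$ ($n\ge1$) are defined by the formal power series identity $$\sum_{n\ge0}D_{n+1}(p,q,t)x^n=\cfrac{1}{1-[1]_{p,q}x-\cfrac{\binom{2}{2}_{p,q}t\,x^2}{1-[2]_{p,q}x-\cfrac{\binom{3}{2}_{p,q}t\,x^2}{1-[3]_{p,q}x-\cdots}}}$$ (level $m$: $b_m=[m+1]_{p,q}$, $\lambda_m=\binom{m+1}{2}_{p,q}t$). Ordinary binomial coefficients $\binom{a}{k}$ with $k>a$ are $0$. *)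

(* Defs.v *)
From HB Require Import structures.
From mathcomp Require Export all_boot all_order all_algebra.
Set Implicit Arguments.
Unset Strict Implicit.
Unset Printing Implicit Defensive.
Import GRing.Theory.
Local Open Scope ring_scope.

(* A formal power series \sum_n f_n x^n over R is its coefficient function
   f : nat -> R. *)
Section FormalPowerSeries.
Variable R : comNzRingType.
Implicit Types (f g : nat -> R) (b lam : nat -> R).

Definition fps_one : nat -> R := fun n => (n == 0%N)%:R.

Definition fps_mul f g : nat -> R :=
  fun n => \sum_(i < n.+1) f i * g (n - i)%N.

(* The first n coefficients of 1/f, for f with constant term 1; fps_mulV below
   shows that fps_inv f is indeed the inverse of f. *)
Fixpoint fps_inv_upto f (n : nat) : seq R :=
  if n is m.+1 then
    let s := fps_inv_upto f m in
    rcons s (fps_one m - \sum_(i < m) f (m - i)%N * s`_i)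
  else [::].

Definition fps_inv f : nat -> R := fun n => (fps_inv_upto f n.+1)`_n.

(* The series 1 - b_m x - lam_(m+1) x^2 F(x). *)
Definition jfrac_den b lam (m : nat) (F : nat -> R) : nat -> R :=
  fun n => match n with
           | 0 => 1
           | 1 => - b m
           | n'.+2 => - (lam m.+1 * F n')
           end.

(* The continued fraction
     1/(1 - b_m x - lam_(m+1) x^2/(1 - b_(m+1) x - lam_(m+2) x^2/(...)))
   truncated by dropping all levels after m + K. *)
Fixpoint jfrac_conv b lam (K m : nat) : nat -> R :=
  fps_inv (jfrac_den b lam m
    (if K is K'.+1 then jfrac_conv b lam K' m.+1 else fun _ => 0)).

(* The infinite continued fraction, i.e. the x-adic limit of its truncations:
   the coefficient of x^n is the same in all truncations with K >= n
   (jfrac_conv_stable). *)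
Definition jfrac b lam (m : nat) : nat -> R :=
  fun n => jfrac_conv b lam n m n.

Lemma size_fps_inv_upto f n : size (fps_inv_upto f n) = n.
Proof. by elim: n => //= n IH; rewrite size_rcons IH. Qed.

Lemma nth_fps_inv_upto f n i :
  (i < n)%N -> (fps_inv_upto f n)`_i = fps_inv f i.
Proof.
elim: n => // n IH; rewrite ltnS leq_eqVlt => /orP[/eqP -> //|ltin].
by rewrite /= nth_rcons size_fps_inv_upto ltin IH.
Qed.

Lemma fps_invE f n :
  fps_inv f n = fps_one n - \sum_(i < n) f (n - i)%N * fps_inv f i.
Proof.
rewrite {1}/fps_inv /= nth_rcons size_fps_inv_upto ltnn eqxx.
by congr (_ - _); apply: eq_bigr => i _; rewrite nth_fps_inv_upto.
Qed.

Lemma fps_mulV f : f 0%N = 1 -> fps_mul f (fps_inv f) =1 fps_one.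
Proof.
move=> f0 n; rewrite /fps_mul (reindex_inj rev_ord_inj) big_ord_recr /=.
rewrite subSS subnn subn0 f0 mul1r [fps_inv f n]fps_invE.
rewrite addrC -addrA -[RHS]addr0; congr (_ + _); apply/eqP.
rewrite addrC subr_eq0; apply/eqP/eq_bigr => i _.
by rewrite subSS subKn // ltnW.
Qed.

Lemma eq_fps_inv f g n :
  (forall i, (i <= n)%N -> f i = g i) -> fps_inv f n = fps_inv g n.
Proof.
elim/ltn_ind: n => n IH fg; rewrite !fps_invE; congr (_ - _).
apply: eq_bigr => i _; rewrite fg ?leq_subr //; congr (_ * _).
apply: IH => // j leji; apply: fg.
exact: leq_trans leji (ltnW (ltn_ord i)).
Qed.

Lemma jfrac_conv_stable b lam K m n :
  (n <= K)%N -> jfrac_conv b lam K m n = jfrac b lam m n.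
Proof.
rewrite /jfrac; elim/ltn_ind: n K m => n IH [|K] m lenK.
  by move: lenK; rewrite leqn0 => /eqP ->.
case: n IH lenK => [|n] IH lenK /=; apply: eq_fps_inv => -[|[|i]] //= lein.
have ltin : (i < n)%N by [].
have leiK : (i <= K)%N by exact: leq_trans (ltnW ltin) lenK.
by rewrite !(IH i) // ltnW.
Qed.

Lemma jfracE b lam m :
  jfrac b lam m =1 fps_inv (jfrac_den b lam m (jfrac b lam m.+1)).
Proof.
move=> n; rewrite -(@jfrac_conv_stable b lam n.+1) //=.
apply: eq_fps_inv => -[|[|i]] //= lein.
by rewrite jfrac_conv_stable // ltnW // ltnW.
Qed.

End FormalPowerSeries.

(* Z[p, q] is {poly {poly int}}: the inner variable is p, the outer one q. *)
Notation Zpq := {poly {poly int}}.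
Definition p_ : Zpq := 'X%:P.
Definition q_ : Zpq := 'X.

Definition pqint (n : nat) : Zpq := \sum_(i < n) p_ ^+ i * q_ ^+ (n.-1 - i).

Definition pqbinom_num (n k : nat) : Zpq := \prod_(i < k) pqint (n - i).
Definition pqbinom_den (k : nat) : Zpq := \prod_(i < k) pqint i.+1.

(* The division is exact in Z[p, q] (pqbinomK), and the denominator is monic
   in q. *)
Definition pqbinom (n k : nat) : Zpq :=
  pqbinom_num n k %/ pqbinom_den k.

Lemma pqintD a b : pqint (a + b) = p_ ^+ a * pqint b + q_ ^+ b * pqint a.
Proof.
rewrite /pqint big_split_ord /= addrC; congr (_ + _); rewrite mulr_sumr.
  apply: eq_bigr => i _; rewrite mulrA -exprD; congr (_ * _ ^+ _).
  by case: b i => [[]//|b] i; rewrite addnS /= subnDl.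
apply: eq_bigr => i _; rewrite mulrCA -exprD; congr (_ * _ ^+ _).
by case: a i => [[]//|a] i /=; rewrite [RHS]addnBA -1?ltnS // addnC.
Qed.

Lemma size_pqint n : (size (pqint n) <= n)%N.
Proof.
apply: (leq_trans (size_sum _ _ _)); apply/bigmax_leqP => i _.
rewrite /p_ /q_ -rmorphXn /= mul_polyC (leq_trans (size_scale_leq _ _)) //.
rewrite size_polyXn; have := ltn_ord i; case: n i => [[]//|n] i _ /=.
by rewrite ltnS leq_subr.
Qed.

Lemma pqint_monic n : pqint n.+1 \is monic.
Proof.
rewrite -add1n pqintD expr1 {2}/pqint big_ord1 !expr0 !mulr1 monicE addrC.
rewrite lead_coefDl ?lead_coefXn // size_polyXn /p_ mul_polyC ltnS.
exact: leq_trans (size_scale_leq _ _) (size_pqint n).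
Qed.

Lemma pqbinom_den_monic k : pqbinom_den k \is monic.
Proof. by apply: monic_prod => i _; apply: pqint_monic. Qed.

Lemma pqbinomK n k : pqbinom n k * pqbinom_den k = pqbinom_num n k.
Proof.
suff [B HB] : exists B, pqbinom_num n k = B * pqbinom_den k.
  rewrite /pqbinom HB Pdiv.IdomainMonic.mulpK //; exact: pqbinom_den_monic.
elim: n k => [|n IH] [|k]; try by exists 1;
  rewrite /pqbinom_num /pqbinom_den !big_ord0 mulr1.
  by exists 0; rewrite mul0r /pqbinom_num big_ord_recl /pqint big_ord0 mul0r.
have numS : pqbinom_num n.+1 k.+1 = pqint n.+1 * pqbinom_num n k.
  by rewrite /pqbinom_num big_ord_recl.
have denS : pqbinom_den k.+1 = pqbinom_den k * pqint k.+1.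
  by rewrite /pqbinom_den big_ord_recr.
have [ltnk|lekn] := ltnP n k.
  exists 0; rewrite mul0r numS /pqbinom_num (bigD1 (Ordinal ltnk)) //=.
  by rewrite subnn /pqint [X in _ * (X * _)]big_ord0 mul0r mulr0.
have [B HB] := IH k; have [C HC] := IH k.+1.
exists (p_ ^+ (n - k) * B + q_ ^+ k.+1 * C).
have -> : pqbinom_num n.+1 k.+1 =
    p_ ^+ (n - k) * (pqbinom_num n k * pqint k.+1) +
    q_ ^+ k.+1 * pqbinom_num n k.+1.
  have -> : pqbinom_num n k.+1 = pqbinom_num n k * pqint (n - k).
    by rewrite /pqbinom_num big_ord_recr.
  rewrite numS -{1}(subnK lekn) -addnS pqintD mulrDl -!mulrA.
  by congr (_ * _ + _ * _); rewrite mulrC.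
by rewrite HB HC denS mulrDl !mulrA.
Qed.

(* D_n(p, q, t) as an element of Z[p, q][t], meaningful for n >= 1. *)
Definition Dpoly (n : nat) : {poly Zpq} :=
  jfrac (fun m => (pqint m.+1)%:P) (fun m => (pqbinom m.+1 2)%:P * 'X) 0 n.-1.

(* D_n(a, b, t) as an element of Z[t]. *)
Definition Dpoly_at (n : nat) (a b : int) : {poly int} :=
  map_poly (fun c : Zpq => c.[b%:P].[a]) (Dpoly n).

(* Main.v *)
Require Import Defs.
From mathcomp Require Import all_boot all_order all_algebra.
From mathcomp Require Import ring zify.
Import GRing.Theory.
Local Open Scope ring_scope.

(** At (p, q) = (1, -1) the continued fraction has b_m = 1, 0, 1, 0, ... and
    lam_m = t, t, 2t, 2t, 3t, 3t, ...  Following Euler, with y = t x^2 / (1 - x)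
    the series
      S_(2j)   = (1 - x)^(-j)   2F0(j, j+1; y),
      S_(2j+1) = (1 - x)^(-j-1) 2F0(j+1, j+1; y)
    satisfy S_(m+1) = S_m + b_m x S_(m+1) + lam_(m+1) x^2 S_(m+2) by the
    contiguity relations of 2F0.  Hence the m-th tail of the fraction is
    S_(m+1) / S_m, and since S_0 = 1 the fraction itself is
    S_1 = \sum_k k! t^k x^(2k) / (1 - x)^(k+1). *)

(** * Power series and tails of a continued fraction *)

Section ContinuedFraction.
Variable R : comNzRingType.
Implicit Types (f g h b lam : nat -> R).

(** Truncation to polynomials lets [fps_mul] inherit the ring laws of [{poly R}]. *)
Lemma fps_mul_coef f g N n : (n < N)%N ->
  fps_mul f g n = ((\poly_(i < N) f i) * (\poly_(i < N) g i))`_n.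
Proof.
move=> ltnN; rewrite coefM; apply: eq_bigr => i _.
by have lein := ltn_ord i; rewrite !coef_poly !ifT //; lia.
Qed.

Lemma fps_mulA f g h n :
  fps_mul (fps_mul f g) h n = fps_mul f (fps_mul g h) n.
Proof.
transitivity (((\poly_(i < n.+1) f i) * (\poly_(i < n.+1) g i) *
               (\poly_(i < n.+1) h i))`_n).
  rewrite coefM; apply: eq_bigr => i _.
  by rewrite (fps_mul_coef _ _ n.+1) // coef_poly ifT //; lia.
rewrite -mulrA coefM; apply: eq_bigr => i _.
by rewrite (fps_mul_coef _ _ n.+1) ?coef_poly ?ltn_ord //; lia.
Qed.

Lemma fps_mulC f g n : fps_mul f g n = fps_mul g f n.
Proof.
by rewrite (fps_mul_coef f g n.+1) // (fps_mul_coef g f n.+1) // mulrC.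
Qed.

Lemma eq_fps_mulr f g h n : (forall i, (i <= n)%N -> g i = h i) ->
  fps_mul f g n = fps_mul f h n.
Proof. by move=> gh; apply: eq_bigr => i _; rewrite gh // leq_subr. Qed.

Lemma fps_mul_jfrac_den b lam m g h n :
  fps_mul (jfrac_den b lam m g) h n.+2 =
  h n.+2 - b m * h n.+1 - lam m.+1 * fps_mul g h n.
Proof.
rewrite /fps_mul big_ord_recl big_ord_recl /= mul1r subn0 addrA mulNr subn1 /=.
congr (_ + _); rewrite mulr_sumr -sumrN; apply: eq_bigr => i _.
by rewrite /= /bump /= !add1n !subSS mulNr mulrA.
Qed.

(** The product [T] of the [m]-th tail with [S m] solves [den * T = S m], where [den] involves the
    next tail. By induction on the coefficient index, this is the recurrence for [S m.+1]. No
    division by [S m] occurs. *)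
Lemma jfrac_ratio b lam (S : nat -> nat -> R) :
  (forall m, S m.+1 0%N = S m 0%N) ->
  (forall m, S m.+1 1%N = S m 1%N + b m * S m.+1 0%N) ->
  (forall m n, S m.+1 n.+2 =
     S m n.+2 + b m * S m.+1 n.+1 + lam m.+1 * S m.+2 n) ->
  forall m n, fps_mul (jfrac b lam m) (S m) n = S m.+1 n.
Proof.
move=> S_0 S_1 S_rec m n; elim/ltn_ind: n m => n IH m.
set T := fps_mul (jfrac b lam m) (S m).
have denT k : fps_mul (jfrac_den b lam m (jfrac b lam m.+1)) T k = S m k.
  rewrite -fps_mulA fps_mulC.
  rewrite (eq_fps_mulr _ _ (@fps_one R)).
    rewrite fps_mulC /fps_mul big_ord_recl /= mul1r subn0 big1 ?addr0 // => i _.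
    by rewrite /fps_one /= mul0r.
  move=> i _; rewrite -(@fps_mulV _ (jfrac_den b lam m (jfrac b lam m.+1))) //.
  by apply: eq_fps_mulr => l _; rewrite -jfracE.
have T0 : T 0%N = S m.+1 0%N.
  by rewrite S_0 -(denT 0%N) /fps_mul big_ord1 /= mul1r.
case: n IH => [//|[|n]] IH.
  rewrite S_1 -(denT 1%N) /fps_mul big_ord_recr big_ord1 /= mul1r.
  by rewrite -T0 mulNr addrNK.
have TS i : (i <= n.+1)%N -> T i = S m.+1 i by move=> lein; apply: IH.
have := denT n.+2; rewrite fps_mul_jfrac_den (TS n.+1) //.
(* Only coefficients of [T] up to [n] matter here; with [T] replaced, the product is the one of
   level [m.+1], to which [IH] applies. *)
rewrite (eq_fps_mulr _ T (S m.+1)) => [|i lein]; last by apply: TS; lia.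
by rewrite IH // S_rec => <-; ring.
Qed.

Lemma eq_jfrac (b b' lam lam' : nat -> R) :
  b =1 b' -> lam =1 lam' -> forall m, jfrac b lam m =1 jfrac b' lam' m.
Proof.
(* The truncation depth is separated from the coefficient index, so that induction on the depth
   applies. *)
move=> eb el m n; rewrite /jfrac; move: {1 3}n => K.
elim: K m n => [|K IH] m n /=; apply: eq_fps_inv => -[|[|i]] _ //=;
  by rewrite ?eb ?el ?IH.
Qed.

End ContinuedFraction.

Section ContinuedFractionMorphism.
Variables (R R' : comNzRingType) (phi : {rmorphism R -> R'}).

Lemma rmorph_fps_inv (f : nat -> R) n :
  phi (fps_inv f n) = fps_inv (phi \o f) n.
Proof.
elim/ltn_ind: n => n IH; rewrite !fps_invE rmorphB rmorph_sum /=.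
congr (_ - _); first by rewrite /fps_one rmorph_nat.
by apply: eq_bigr => i _; rewrite rmorphM IH.
Qed.

Lemma rmorph_jfrac (b lam : nat -> R) m n :
  phi (jfrac b lam m n) = jfrac (phi \o b) (phi \o lam) m n.
Proof.
rewrite /jfrac; move: {1 3}n => K; elim: K m n => [|K IH] m n /=;
  rewrite rmorph_fps_inv; apply: eq_fps_inv => -[|[|i]] _ /=;
  by rewrite ?rmorph1 ?rmorphN ?rmorphM ?rmorph0 ?IH.
Qed.

End ContinuedFractionMorphism.

(** * Specialization at p = 1, q = -1 *)

(** A Pascal rule: split [n+2] as p^n [2] + q^2 [n] in the numerator, then cancel the monic
    denominator. *)
Lemma pqbinom2S n :
  pqbinom n.+2 2 = p_ ^+ n * pqint n.+1 + q_ ^+ 2 * pqbinom n.+1 2.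
Proof.
have den_neq0 := monic_neq0 (pqbinom_den_monic 2).
apply: (mulIf den_neq0); rewrite mulrDl -(mulrA (q_ ^+ 2)) !pqbinomK.
have int1 : pqint 1 = 1 by rewrite /pqint big_ord1 !expr0 mulr1.
have := pqintD n 2; rewrite addn2.
rewrite /pqbinom_num /pqbinom_den !big_ord_recr !big_ord0 /= !mul1r.
rewrite !subn0 !subn1 /= int1 mul1r => ->.
ring.
Qed.

Definition eval_at (a b : int) : {rmorphism Zpq -> int} :=
  horner_eval a \o horner_eval b%:P.

Lemma eval_p a b : eval_at a b p_ = a.
Proof. by rewrite /= /horner_eval /p_ hornerC hornerX. Qed.

Lemma eval_q a b : eval_at a b q_ = b.
Proof. by rewrite /= /horner_eval /q_ hornerX hornerC. Qed.

Lemma eval_pqint n : eval_at 1 (-1) (pqint n) = (odd n)%:R.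
Proof.
elim: n => [|n IH]; first by rewrite /pqint big_ord0 rmorph0.
rewrite -addn1 pqintD rmorphD !rmorphM !rmorphXn eval_p eval_q IH.
rewrite /pqint big_ord1 !expr0 mulr1 rmorph1 expr1n addn1 /=.
by case: (odd n).
Qed.

Lemma eval_pqbinom2 n : eval_at 1 (-1) (pqbinom n.+1 2) = (uphalf n)%:R.
Proof.
elim: n => [|n IH].
  rewrite /pqbinom /pqbinom_num !big_ord_recr big_ord0 /= {2}/pqint big_ord0.
  by rewrite mulr0 div0p !rmorph0.
rewrite pqbinom2S rmorphD !rmorphM !rmorphXn eval_p eval_q IH eval_pqint.
rewrite expr1n mul1r mulrNN !mul1r -natrD; congr (_%:R); lia.
Qed.

(** * Euler's series and their recurrence *)

(* The coefficient of x^n in (1 - x)^(-r); the truncated predecessor gives the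
   right value at r = 0. *)
Definition negbin (r n : nat) : nat := 'C((n + r).-1, n)%N.

Lemma negbinSS r n : negbin r.+1 n.+1 = (negbin r n.+1 + negbin r.+1 n)%N.
Proof. by rewrite /negbin !addnS !addSn /= binS. Qed.

(** The boolean treats both parities of [m] at once: from S_m to S_(m+1) the exponent of 1/(1 - x)
    grows by [~~ odd m]. *)
Lemma negbin_parity (r n : nat) (o : bool) :
  negbin (r + o) n.+1 = (negbin r n.+1 + o * negbin (r + o) n)%N.
Proof. by case: o; rewrite ?addn0 // addn1 mul1n negbinSS. Qed.

Lemma negbin0 r : negbin r 0 = 1%N.
Proof. by rewrite /negbin bin0. Qed.

(* The coefficient of y^k in 2F0(j, j+1; y) if m = 2j, and in
   2F0(j+1, j+1; y) if m = 2j+1. *)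
Definition hyp_coef (m k : nat) : nat :=
  ('C((k + uphalf m).-1, k) * (m./2 + k) ^_ k)%N.

Lemma hyp_coef0 m : hyp_coef m 0 = 1%N.
Proof. by rewrite /hyp_coef bin0 ffactn0. Qed.

(** The contiguity relation of 2F0, by absorption for odd [m] and by Pascal's rule for even [m]. *)
Lemma hyp_coefS m k :
  hyp_coef m.+1 k.+1 = (hyp_coef m k.+1 + m./2.+1 * hyp_coef m.+2 k)%N.
Proof.
rewrite /hyp_coef /= !addSn !addnS /=.
have := odd_double_half m; set j := m./2; case: (odd m) => /= mE.
  have -> : uphalf m = j.+1 by lia.
  rewrite addnS addSn /= (addnC k j).
  have E1 := mul_bin_left (j + k).+1 k.
  have E2 := ffactnSr (j + k).+1 k.
  have E3 := ffactSS (j + k).+1 k.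
  have jE : ((j + k).+1 - k = j.+1)%N by lia.
  move: E1 E2 E3; rewrite jE => E1 -> ->.
  (* After removal of the common factor [Z], what remains is (k+1) X = (j+1) Y, which is [E1]. *)
  set X := 'C(_, k.+1) in E1 *; set Y := 'C(_, k) in E1 *; set Z := _ ^_ k.
  nia.
have -> : uphalf m = j by lia.
rewrite (addnC k j) binS ffactnSr.
have -> : ((j + k).+1 - k = j.+1)%N by lia.
ring.
Qed.

(* The coefficient of t^k x^n in S_m. *)
Definition euler_coef (m n k : nat) : nat :=
  (if k.*2 <= n then hyp_coef m k * negbin (k + uphalf m) (n - k.*2) else 0)%N.

Lemma uphalfSodd m : uphalf m.+1 = (uphalf m + ~~ odd m)%N.
Proof. lia. Qed.

Lemma euler_coef0S m n :
  euler_coef m.+1 n.+1 0 =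
  (euler_coef m n.+1 0 + ~~ odd m * euler_coef m.+1 n 0)%N.
Proof.
rewrite /euler_coef double0 !leq0n !hyp_coef0 !mul1n !add0n !subn0.
by rewrite uphalfSodd negbin_parity.
Qed.

(** The S_m and S_(m+2) terms carry the same power of 1/(1 - x), so [hyp_coefS] merges them;
    [negbin_parity] then absorbs the middle term. *)
Lemma euler_coefSS m n k :
  euler_coef m.+1 n.+2 k.+1 =
  (euler_coef m n.+2 k.+1 + ~~ odd m * euler_coef m.+1 n.+1 k.+1 +
   m./2.+1 * euler_coef m.+2 n k)%N.
Proof.
rewrite /euler_coef doubleS !ltnS !subSS.
case: (leqP k.*2 n) => [le2kn|gt2kn]; last by rewrite ltnNge ltnW //= !muln0.
rewrite uphalfSodd addnA (_ : uphalf m.+2 = (uphalf m).+1) // addnS -addSn.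
rewrite hyp_coefS.
have [lt2kn|ge2kn] := ltnP k.*2 n.
  have [q ->] : exists q, n = (k.*2 + q.+1)%N by exists (n - k.*2).-1; lia.
  rewrite !addnS subSS !(addKn, =^~ addnS) negbin_parity; ring.
(* On this boundary the middle term is 0 and only [hyp_coefS] is at work. *)
have -> : n = k.*2 by lia.
rewrite subnn !negbin0; ring.
Qed.

(** The variable is t. The bound exceeds the degree [n./2] but matches the range of the final
    sum. *)
Definition euler_series (m n : nat) : {poly int} :=
  \poly_(k < n.+1) (euler_coef m n k)%:R.

Lemma coef_euler_series m n k :
  (euler_series m n)`_k = (euler_coef m n k)%:R.
Proof.
rewrite coef_poly; case: ltnP => // ltnk.
by rewrite /euler_coef ifF //; lia.
Qed.

(** S_0 = 1, since the upper parameter j = 0 kills all terms of 2F0 past the first; [m] is the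
    exponent of x here. *)
Lemma euler_series0 m : euler_series 0 m = fps_one _ m.
Proof.
apply/polyP => k; rewrite coef_euler_series /fps_one -polyC_natr coefC.
rewrite /euler_coef /hyp_coef /negbin /= add0n addn0.
case: k => [|k]; last by rewrite /= bin_small // mul0n; case: ifP.
case: m => [|m] /=; first by rewrite ffactn0.
by rewrite double0 subn0 addn0 (bin_small (ltnSn m)) muln0.
Qed.

Lemma jfrac_euler n :
  jfrac (fun m => (~~ odd m)%:R) (fun m => (uphalf m)%:R * 'X) 0 n =
  euler_series 1 n.
Proof.
set b := fun m => _; set lam := fun m => _.
rewrite -(jfrac_ratio _ b lam euler_series) // {}/b {}/lam.
- rewrite fps_mulC /fps_mul big_ord_recl /= subn0 euler_series0 mul1r.
  by rewrite big1 ?addr0 // => i _; rewrite euler_series0 /fps_one mul0r.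
- move=> m; apply/polyP => -[|k]; rewrite !coef_euler_series //.
  by rewrite /euler_coef /= !hyp_coef0 !negbin0.
- move=> m; apply/polyP => -[|k]; rewrite coefD mulr_natl coefMn.
    by rewrite !coef_euler_series euler_coef0S natrD natrM mulr_natl.
  by rewrite !coef_euler_series /euler_coef /= mul0rn.
move=> m n'; apply/polyP => k; rewrite !coefD -mulrA !mulr_natl !coefMn coefXM.
rewrite !coef_euler_series; case: k => [|k] /=.
  by rewrite mul0rn addr0 euler_coef0S natrD natrM mulr_natl.
by rewrite euler_coefSS -!mulrnA -!natrD ![(euler_coef _ _ _ * _)%N]mulnC.
Qed.

Lemma euler_coef1 n k : euler_coef 1 n k = ('C(n - k, k) * k`!)%N.
Proof.
rewrite /euler_coef /hyp_coef /negbin /= !addn1 /= add0n binn mul1n ffactnn.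
case: leqP => [le2kn|lt]; last by rewrite bin_small //; lia.
have -> : (n - k.*2 + k.+1).-1 = (n - k)%N by lia.
by rewrite mulnC -[in LHS]bin_sub; [congr ('C(_, _) * _)%N|]; lia.
Qed.

Theorem theorem3p7 (n : nat) (hn : (1 <= n)%N) :
  Dpoly_at n 1 (-1) =
  \sum_(0 <= k < n) ('C(n - 1 - k, k) * k`!)%:R *: 'X^k.
Proof.
case: n hn => // n _; rewrite subn1 /=.
(* By conversion, the evaluation becomes a ring morphism, which can enter the fraction. *)
transitivity (map_poly (eval_at 1 (-1)) (Dpoly n.+1)); first by [].
rewrite /Dpoly rmorph_jfrac.
rewrite (eq_jfrac _ _ (fun m => (~~ odd m)%:R) _ (fun m => (uphalf m)%:R * 'X)).
- rewrite jfrac_euler /euler_series poly_def big_mkord.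
  by apply: eq_bigr => k _; rewrite euler_coef1.
- move=> m; rewrite -polyC_natr -[(~~ odd m)%:R](eval_pqint m.+1).
  exact: map_polyC.
move=> m; apply: etrans (rmorphM _ _ _) _; congr (_ * _); last exact: map_polyX.
rewrite -polyC_natr -eval_pqbinom2; exact: map_polyC.
Qed.
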